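(* Let $d\in\mathbb N$. The completion of the set $\{\mathbf 1\}$ with respect to the operations $\circledast$, $\mathcal E$ and $\lfloor\cdot\rfloor_i$, $i\in\{1,\dots,d\}$ (i.e. the smallest subset of $\mathcal F_{0,d}[0]$ containing $\mathbf 1$ and closed under these operations) is the complete set of Lions forests $\mathcal F_{0,d}[0]$.
   Context: Directed forests. A directed forest $(\mathcal N,E)$ consists of a finite set of nodes $\mathcal N$ and edges $E\subseteq \mathcal N\times\mathcal N$, such that the graph is acyclic and each connected component is a tree whose edges all point towards a single node, its root. Each non-root node $x$ has exactly one parent $y$, $(x,y)\in E$. The depth of a node is the number of edges of its path to its root; $x<y$ means depth$(x)<$ depth$(y)$ and $x\lesseqqgtr y$ means equal depths. Lions forests. $\mathcal F_{0,d}[0]$ is the set of tuples $T=(\mathcal N,E,h_0,H,\mathcal L)$, up to isomorphism (so disjoint representatives can always be chosen), where $(\mathcal N,E)$ is a directed forest, $\mathcal L:\mathcal N\to\{1,\dots,d\}$, $h_0\subseteq\mathcal N$ (the tagged hyperedge, possibly empty) and $H$ is a partition of $\mathcal N\setminus h_0$ into non-empty blocks, such that with $H'=(H\cup\{h_0\})\setminus\{\emptyset\}$: (1) if $h\in H'$, $x,y\in h$, $x<y$, then there is $z\in h$ with $(y,z)\in E$; (2) if $h\in H'$, $x_1,y_1\in h$, $x_1\lesseqqgtr y_1$, $(x_1,x_2),(y_1,y_2)\in E$, $x_2\ne y_2$, then $x_2,y_2\in h$; (3) if $h_0\ne\emptyset$ then $h_0$ contains a root. The empty forest $\mathbf 1=(\emptyset,\emptyset,\emptyset,\emptyset,\emptyset)$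 is included. Operations. Product: $T_1\circledast T_2=(\mathcal N^1\cup\mathcal N^2,E^1\cup E^2,h_0^1\cup h_0^2,H^1\cup H^2,\mathcal L)$ with $\mathcal L|_{\mathcal N^i}=\mathcal L^i$ (node sets disjoint). Decoupling: $\mathcal E[T]=(\mathcal N,E,\emptyset,H',\mathcal L)$ with $H'=(H\cup\{h_0\})\setminus\{\emptyset\}$. Rooting: $\lfloor T\rfloor_i=(\mathcal N\cup\{x_0\},\,E\cup\{(x,x_0):x\text{ a root of }T\},\,h_0\cup\{x_0\},\,H,\,\tilde{\mathcal L})$ where $x_0\notin\mathcal N$ is a new node, $\tilde{\mathcal L}|_{\mathcal N}=\mathcal L$ and $\tilde{\mathcal L}(x_0)=i$. *)

(* Defs.v *)
From mathcomp Require Import all_boot.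

Set Implicit Arguments.
Unset Strict Implicit.
Unset Printing Implicit Defensive.

Section DirectedForest.
Variables (N : finType) (e : rel N).

Definition undirected : rel N := fun x y => e x y || e y x.

(* No directed cycle (in particular no loop and no pair of opposite edges), and
   no cycle in the underlying undirected graph, whose simple cycles have at
   least three nodes. *)
Definition acyclic : Prop :=
  (forall x p, path e x p -> last x p = x -> p = [::])
  /\ (forall c, uniq c -> 2 < size c -> ~~ cycle undirected c).

(* All edges of the connected component of [r] point towards [r]: when the
   component is a tree, the directed path from [y] to [r] is its unique path
   from [y] to [r]. *)
Definition is_root (r : N) : bool :=
  [forall y, connect undirected r y ==> connect e y r].

Definition directed_forest : Prop :=
  acyclic /\ forall x, exists! r, connect undirected x r /\ is_root r.

(* Least length of a directed path from [x] to a root. In a directed forest this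
   path is unique and has fewer than #|N| edges; for other relations the value
   carries no meaning. *)
Definition depth (x : N) : nat :=
  find (fun n => [exists p : n.-tuple N, path e x p && is_root (last x p)])
       (iota 0 #|N|).

End DirectedForest.

(* The tuples (N, E, h0, H, L), without any condition on the components; the
   labels {1, ..., d} are represented by 'I_d. *)
Record hypergraph (d : nat) := Hypergraph {
  node : finType;
  edge : rel node;
  tagged_edge : {set node};
  untagged_edges : {set {set node}};
  label : node -> 'I_d
}.

Section LionsForest.
Variable d : nat.
Implicit Type T : hypergraph d.

(* H' = (H \cup {h0}) \ {emptyset} *)
Definition hyperedges T : {set {set node T}} :=
  (untagged_edges T :|: [set tagged_edge T]) :\ set0.

Definition is_lions_forest T : Prop :=
  [/\ directed_forest (@edge d T),
      partition (untagged_edges T) (~: tagged_edge T),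
      forall (h : {set node T}) (x y : node T),
        h \in hyperedges T -> x \in h -> y \in h ->
        depth (@edge d T) x < depth (@edge d T) y ->
        exists2 z, z \in h & edge y z,
      forall (h : {set node T}) (x1 y1 x2 y2 : node T),
        h \in hyperedges T -> x1 \in h -> y1 \in h ->
        depth (@edge d T) x1 = depth (@edge d T) y1 ->
        edge x1 x2 -> edge y1 y2 -> x2 <> y2 ->
        x2 \in h /\ y2 \in h
    & tagged_edge T <> set0 ->
        exists2 r, r \in tagged_edge T & is_root (@edge d T) r].

Definition isomorphic T1 T2 : Prop :=
  exists f : node T1 -> node T2,
    [/\ bijective f,
        forall x y, edge (f x) (f y) = edge x y,
        f @: tagged_edge T1 = tagged_edge T2,
        [set f @: (h : {set node T1}) | h in untagged_edges T1]
          = untagged_edges T2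
      & forall x, label (f x) = label x].

Definition empty_forest : hypergraph d :=
  @Hypergraph d void (fun _ _ => false) set0 set0 (of_void 'I_d).

Definition product T1 T2 : hypergraph d :=
  @Hypergraph d (node T1 + node T2)%type
    (fun u v => match u, v with
                | inl x, inl y => edge x y
                | inr x, inr y => edge x y
                | _, _ => false
                end)
    (inl @: tagged_edge T1 :|: inr @: tagged_edge T2)
    ([set inl @: (h : {set node T1}) | h in untagged_edges T1] :|:
     [set inr @: (h : {set node T2}) | h in untagged_edges T2])
    (fun u => match u with inl x => label x | inr x => label x end).

Definition decoupling T : hypergraph d :=
  @Hypergraph d (node T) (@edge d T) set0 (hyperedges T) (@label d T).

(* The new node x_0 is [None]. *)
Definition rooting (i : 'I_d) T : hypergraph d :=
  @Hypergraph d (option (node T))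
    (fun u v => match u, v with
                | Some x, Some y => edge x y
                | Some x, None => is_root (@edge d T) x
                | None, _ => false
                end)
    (None |: Some @: tagged_edge T)
    [set Some @: (h : {set node T}) | h in untagged_edges T]
    (fun u => if u is Some x then label x else i).

(* The smallest set containing [A] and closed under the three operations. Lions
   forests are considered up to isomorphism, so that a set of Lions forests is
   a set of tuples that is closed under isomorphism. *)
Inductive completion (A : hypergraph d -> Prop) : hypergraph d -> Prop :=
  | completion_base T : A T -> completion A T
  | completion_isomorphic T1 T2 :
      isomorphic T1 T2 -> completion A T1 -> completion A T2
  | completion_product T1 T2 :
      completion A T1 -> completion A T2 -> completion A (product T1 T2)
  | completion_decoupling T : completion A T -> completion A (decoupling T)
  | completion_rooting i T : completion A T -> completion A (rooting i T).

End LionsForest.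

(* Main.v *)
Require Import Defs.
From mathcomp Require Import all_boot.

Set Implicit Arguments.
Unset Strict Implicit.
Unset Printing Implicit Defensive.

(** Both inclusions are by induction. Being a directed forest is first reduced
    to the existence of a depth function [g]: every node has at most one parent,
    [g] increases by one from parent to child, and the nodes without parent are
    those with [g x = 0]
    ([depth_is_depth], [depth_directed_forest]). In terms of [g], conditions
    (1), (2) and (3) on the tagged hyperedge together say that it is closed
    under taking parents ([is_lions_forestP]), because a coherent hyperedge that
    contains a root contains the parents of all its nodes. With this
    reformulation it is a direct verification that the three operations and
    isomorphisms preserve Lions forests ([completion_lions]).

    Conversely ([lions_completion]), let [T] be a nonempty Lions forest.
    - If no hyperedge is tagged, tag the hyperedge of some root: this gives a
      Lions forest whose decoupling is [T] ([lions_tagging]).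
    - Otherwise the tagged hyperedge contains a root [r]. If the tree of [r] is
      all of [T], then [T] is the rooting of the Lions forest obtained by
      deleting [r] ([rooting_isomorphic]).
    - If there are other trees, then [T] is the product of the tree of [r] and
      the forest of the other trees ([product_isomorphic]). A hyperedge that
      meets both parts contains [r], as one sees by climbing to the roots, so
      only the tagged hyperedge is split.
    In the last two cases the new forests have fewer nodes than [T], and the
    first case leads to them. *)

(** * Depth functions of directed forests *)

(** [g] is a depth function for [e]: every node has at most one parent, depth
    increases by one from a parent to its children, and exactly the nodes of
    depth zero have no parent. The existence of [g] characterizes the directed
    forests. *)
Definition is_depth (N : finType) (e : rel N) (g : N -> nat) : Prop :=
  [/\ forall x y z, e x y -> e x z -> y = z,
      forall x y, e x y -> g x = (g y).+1
    & forall x, 0 < g x -> exists y, e x y].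

Section DepthOfRootPath.
Variables (N : finType) (e : rel N).
Hypothesis e_fun : forall x y z, e x y -> e x z -> y = z.

Lemma path_to_sink_unique x p q :
  path e x p -> path e x q ->
  (forall y, ~~ e (last x p) y) -> (forall y, ~~ e (last x q) y) -> p = q.
Proof.
elim: p x q => [|y p IHp] x [|z q] //=.
- by move=> _ /andP[xz _] /(_ z); rewrite xz.
- by move=> /andP[xy _] _ _ /(_ y); rewrite xy.
move=> /andP[xy py] /andP[xz qz] sp sq.
by rewrite -(e_fun xy xz) in qz sq *; rewrite (IHp y q).
Qed.

Hypothesis root_sink : forall r y, is_root e r -> ~~ e r y.

(** The bound in the definition of [depth] is no restriction: the path is the
    only one from [x] to a root, so it is its own shortening to a simple path. *)
Lemma depth_path_to_root x p :
  path e x p -> is_root e (last x p) -> depth e x = size p.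
Proof.
move=> xp rp.
have sp y : ~~ e (last x p) y by apply: root_sink.
have ltpN : size p < #|N|.
  have [p' xp' [Up' Dlast]] :
      exists2 p', path e x p' & uniq (x :: p') /\ last x p = last x p'.
    by case: (shortenP xp) => p' xp' Up' _; exists p'.
  have -> : p = p' by apply: path_to_sink_unique xp xp' _ _; rewrite -?Dlast.
  by rewrite -[(size p').+1]/(size (x :: p')) -(card_uniqP Up') max_card.
have root_path_size n :
    [exists q : n.-tuple N, path e x q && is_root e (last x q)] = (n == size p).
  apply/existsP/eqP => [[q /andP[xq rq]] | ->]; last first.
    by exists (in_tuple p); rewrite xp.
  rewrite -(size_tuple q); congr size.
  by apply: path_to_sink_unique xq xp _ sp => y; apply: root_sink.
rewrite /depth (eq_find root_path_size) -[find _ _]/(index (size p) _).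
by rewrite -{1}[size p](nth_iota 0 0 ltpN) index_uniq ?size_iota ?iota_uniq.
Qed.

End DepthOfRootPath.

Section DirectedForestDepth.
Variables (N : finType) (e : rel N).

Lemma undirectedC : connect_sym (undirected e).
Proof. by apply: sym_connect_sym => x y; rewrite /undirected orbC. Qed.

Lemma connect_directed x y : connect e x y -> connect (undirected e) x y.
Proof. by apply: connect_sub => u v uv; rewrite connect1 // /undirected uv. Qed.

Lemma acyclic_no_return x y : acyclic e -> e x y -> ~~ connect e y x.
Proof.
case=> acyc _ xy; apply/negP => /connectP[p yp Dx].
by have /= := acyc x (y :: p); rewrite xy yp -Dx => /(_ isT erefl).
Qed.

Lemma root_has_no_parent r y : acyclic e -> is_root e r -> ~~ e r y.
Proof.
move=> acyc /forallP/(_ y)/implyP root_r; apply/negP => ry.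
case/negP: (acyclic_no_return acyc ry); apply: root_r.
by apply: connect_directed; apply: connect1.
Qed.

(** Two parents [y] and [z] of [x] have directed paths to the same root, which
    avoid [x]; closing up a simple path from [y] to [z] through [x] gives an
    undirected cycle. *)
Lemma directed_forest_functional x y z :
  directed_forest e -> e x y -> e x z -> y = z.
Proof.
case=> acyc rooted xy xz; apply/eqP/negPn/negP => neq_yz.
have [r [[xr root_r] _]] := rooted x.
pose ux := [rel a b | [&& undirected e a b, a != x & b != x]].
have uxC : connect_sym ux.
  apply: sym_connect_sym => a b /=.
  by rewrite /undirected orbC [(a != x) && _]andbC.
have avoid a : e x a -> connect ux a r.
  move=> xa; have rxa := acyclic_no_return acyc xa.
  have /connectP[p ap ->] : connect e a r.
    move/forallP/(_ a)/implyP: root_r; apply.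
    rewrite undirectedC in xr.
    exact: connect_trans xr (connect_directed (connect1 xa)).
  elim: p a {xa} rxa ap => [|b p IHp] a rxa /=; first by rewrite connect0.
  case/andP=> ab bp; have rxb : ~~ connect e b x.
    by apply: contra rxa; apply: connect_trans (connect1 ab).
  apply: connect_trans (IHp b rxb bp); apply: connect1 => /=.
  rewrite /undirected ab /=; apply/andP; split.
    by apply: contraNneq rxa => ->; apply: connect0.
  by apply: contraNneq rxb => ->; apply: connect0.
have /connectP[p0 yp0 Dz0] : connect ux y z.
  by apply: connect_trans (avoid y xy) _; rewrite uxC; apply: avoid.
have [p [yp Up Dz]] : exists p, [/\ path ux y p, uniq (y :: p) & last y p = z].
  by rewrite Dz0; case: (shortenP yp0) => p yp Up _; exists p.
have neq_xy : x \notin y :: p.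
  rewrite inE negb_or; apply/andP; split.
    apply: contraTneq xy => <-; apply/negP => xx.
    by case/negP: (acyclic_no_return acyc xx); apply: connect0.
  elim: p y yp {Up Dz xy neq_yz yp0 Dz0} => //= b p IHp y.
  by case/andP=> /and3P[_ _ bx] bp; rewrite inE negb_or eq_sym bx (IHp b).
case: acyc => _ /(_ [:: x, y & p]); rewrite cons_uniq neq_xy Up.
case: p => [|b p] in yp Dz neq_xy Up *; first by rewrite -Dz eqxx in neq_yz.
move=> /(_ isT isT)/negP; apply.
have -> : cycle (undirected e) [:: x, y, b & p] =
          undirected e x y && path (undirected e) y (rcons (b :: p) x) by [].
rewrite rcons_path Dz /undirected xy xz orbT andbT.
by apply: sub_path yp => a c /and3P[].
Qed.

Lemma depth_is_depth : directed_forest e -> is_depth e (depth e).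
Proof.
move=> forest; have [acyc rooted] := forest.
have e_fun x y z : e x y -> e x z -> y = z by apply: directed_forest_functional.
have root_sink r y : is_root e r -> ~~ e r y by apply: root_has_no_parent.
have root_path x : exists2 p, path e x p & is_root e (last x p).
  have [r [[]]] := rooted x; rewrite undirectedC => rx root_r _.
  have /forallP/(_ x) := root_r; rewrite rx => /connectP[p xp Dr].
  by exists p; rewrite -?Dr.
have depthE := depth_path_to_root e_fun root_sink.
split=> // [x y xy | x].
  have [p yp rp] := root_path y.
  by rewrite (depthE y p) // (depthE x (y :: p)) //= xy.
have [[|y p] /= xp rp] := root_path x; first by rewrite (depthE x [::]).
by exists y; case/andP: xp.
Qed.

Section FromDepth.
Variable g : N -> nat.
Hypothesis eg : is_depth e g.

Lemma depth_fun x y z : e x y -> e x z -> y = z.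
Proof. by case: eg => f _ _; apply: f. Qed.

Lemma depth_edge x y : e x y -> g x = (g y).+1.
Proof. by case: eg => _ f _; apply: f. Qed.

Lemma depth_parent x : 0 < g x -> exists y, e x y.
Proof. by case: eg => _ _; apply. Qed.

Lemma depth0_no_parent x y : g x = 0 -> ~~ e x y.
Proof. by move=> gx0; apply/negP => /depth_edge; rewrite gx0. Qed.

Lemma connect_depth0 x y : g x = 0 -> connect e x y -> y = x.
Proof.
move=> gx0 /connectP[[|z p] //= /andP[xz _] _].
by case/negP: (depth0_no_parent z gx0).
Qed.

Lemma depth_path x p : path e x p -> g x = g (last x p) + size p.
Proof.
elim: p x => [|y p IHp] x /=; first by rewrite addn0.
by case/andP=> /depth_edge-> /IHp->; rewrite addnS.
Qed.

Lemma depth_root_path x : exists2 p, path e x p & g (last x p) = 0.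
Proof.
elim: {x}(g x) {-2}x (erefl (g x)) => [|n IHn] x gx; first by exists [::].
have [|y xy] := depth_parent (x := x); first by rewrite gx.
have [|p yp gp] := IHn y; first by move: (depth_edge xy); rewrite gx => -[].
by exists (y :: p); rewrite //= xy.
Qed.

Lemma connect_parent x y z : g z = 0 -> e x y -> connect e x z -> connect e y z.
Proof.
move=> gz0 xy /connectP[[|y' p] /= xp Dz].
  by move: (depth_edge xy); rewrite -Dz gz0.
case/andP: xp => /(depth_fun xy)-> yp.
by apply/connectP; exists p.
Qed.

Lemma connect_undirected_depth0 r x :
  g r = 0 -> connect (undirected e) r x -> connect e x r.
Proof.
move=> gr0 /connectP[p rp ->].
elim/last_ind: p rp => [|p y IHp]; first by rewrite connect0.
rewrite rcons_path last_rcons => /andP[/IHp xr /orP[xy | yx]].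
  exact: connect_parent xr.
by apply: connect_trans xr; apply: connect1.
Qed.

Lemma depth_acyclic : acyclic e.
Proof.
split=> [x p xp px | c Uc c_gt2].
  by have := depth_path xp; rewrite px -[LHS]addn0 => /addnI; case: p {xp px}.
(* Both neighbours in [c] of a node [x] of maximal depth are parents of [x]. *)
apply/negP => cyc_c.
have [x0 cx0] : exists x0, x0 \in c.
  by case: c c_gt2 {Uc cyc_c} => // x0 c; exists x0; apply: mem_head.
have [x cx max_x] := arg_maxnP g cx0.
have [i c' Dc] := rot_to cx.
have {}max_x y : undirected e x y -> y \in x :: c' -> e x y.
  rewrite -Dc mem_rot => /orP[// | /depth_edge gy] /max_x.
  by rewrite /= gy ltnn.
rewrite -(rot_cycle i) Dc in cyc_c.
rewrite -(rot_uniq i) Dc in Uc; rewrite -(size_rot i) Dc in c_gt2.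
case: c' Uc c_gt2 cyc_c max_x {Dc} => // y c'; case/lastP: c' => // c' z.
rewrite /= rcons_path last_rcons.
rewrite mem_rcons inE negb_or => /and3P[_ /andP[neq_yz _] _] _.
move=> /and3P[xy _ zx] max_x; case/eqP: neq_yz; apply: (@depth_fun x).
  by apply: max_x => //; rewrite !inE eqxx orbT.
apply: max_x; first by rewrite /undirected orbC.
by rewrite !inE mem_rcons mem_head !orbT.
Qed.

Lemma depth_is_root x : is_root e x = (g x == 0).
Proof.
apply/idP/eqP => [root_x | gx0].
  case: (posnP (g x)) => // /depth_parent[y xy].
  by case/negP: (root_has_no_parent y depth_acyclic root_x).
by apply/forallP => y; apply/implyP; apply: connect_undirected_depth0.
Qed.

Lemma depth_directed_forest : directed_forest e.
Proof.
split=> [|x]; first exact: depth_acyclic.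
have [p xp gp] := depth_root_path x.
have xr : connect e x (last x p) by apply/connectP; exists p.
exists (last x p); split; first by rewrite depth_is_root gp connect_directed.
move=> r [ur root_r]; have gr0 : g r = 0 by apply/eqP; rewrite -depth_is_root.
apply: (connect_depth0 gr0); apply: connect_undirected_depth0 gp _.
by apply: connect_trans ur; rewrite undirectedC; apply: connect_directed.
Qed.

Lemma depth_unique x : depth e x = g x.
Proof.
have [p xp gp] := depth_root_path x.
rewrite (depth_path xp) gp; apply: depth_path_to_root => //.
- exact: depth_fun.
- by move=> r y; rewrite depth_is_root => /eqP/depth0_no_parent.
- by rewrite depth_is_root gp.
Qed.

End FromDepth.
End DirectedForestDepth.

(** * Lions forests relative to a depth function *)

(** Conditions (1) and (2) of a Lions forest on a single hyperedge [h], for the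
    depth function [g]. *)
Definition coherent (N : finType) (e : rel N) (g : N -> nat) (h : {set N}) :
    Prop :=
  (forall x y, x \in h -> y \in h -> g x < g y -> exists2 z, z \in h & e y z)
  /\ (forall x1 y1 x2 y2, x1 \in h -> y1 \in h -> g x1 = g y1 ->
        e x1 x2 -> e y1 y2 -> x2 <> y2 -> x2 \in h /\ y2 \in h).

(** [h] contains the parents of its nodes. *)
Definition parent_closed (N : finType) (e : rel N) (h : {set N}) : Prop :=
  forall x y, e x y -> x \in h -> y \in h.

(** The conditions of a Lions forest, for a depth function [g] of the edges.
    That the tagged hyperedge satisfies conditions (1), (2) and (3) amounts to
    its being closed under parents. *)
Definition lions_wrt d (T : hypergraph d) (g : node T -> nat) : Prop :=
  [/\ is_depth (@edge d T) g,
      partition (untagged_edges T) (~: tagged_edge T),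
      forall h : {set node T}, h \in untagged_edges T -> coherent (@edge d T) g h
    & parent_closed (@edge d T) (tagged_edge T)].

(** Partitions in terms of elements. *)
Lemma partitionE (N : finType) (P : {set {set N}}) (D : {set N}) :
  partition P D <->
  [/\ set0 \notin P,
      forall x, (x \in D) <-> (exists2 h, h \in P & x \in h)
    & forall h h' x, h \in P -> h' \in P -> x \in h -> x \in h' -> h = h'].
Proof.
split=> [partP | [nP0 coverP disjP]].
  have /and3P[/eqP covP trivP nP0] := partP; split=> // [x|h h' x Ph Ph' hx h'x].
    rewrite -covP; split=> [/bigcupP[h]|[h Ph hx]]; first by exists h.
    by apply/bigcupP; exists h.
  by rewrite -(def_pblock trivP Ph hx); apply: def_pblock.
apply/and3P; split=> //.
  apply/eqP/setP => x; apply/bigcupP/idP => [[h Ph hx] | /coverP[h Ph hx]].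
    by apply/coverP; exists h.
  by exists h.
apply/trivIsetP => h h' Ph Ph'; apply: contraNT => /pred0Pn[x /andP[hx h'x]].
exact/eqP/(disjP h h' x).
Qed.

Lemma partition_setU (N : finType) (P1 P2 : {set {set N}}) (D1 D2 : {set N}) :
  [disjoint D1 & D2] -> partition P1 D1 -> partition P2 D2 ->
  partition (P1 :|: P2) (D1 :|: D2).
Proof.
move=> dis /partitionE[n1 cov1 dis1] /partitionE[n2 cov2 dis2].
have no_meet h h' x : h \in P1 -> h' \in P2 -> x \in h -> x \notin h'.
  move=> Ph Ph' hx; apply/negP => h'x.
  have D1x : x \in D1 by apply/cov1; exists h.
  by have /negP := disjointFr dis D1x; apply; apply/cov2; exists h'.
apply/partitionE; split=> [|x|h h' x].
- by rewrite inE negb_or n1.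
- rewrite inE; split=> [/orP[/cov1 | /cov2] [h Ph hx] | [h]].
  + by exists h; rewrite // inE Ph.
  + by exists h; rewrite // inE Ph orbT.
  + rewrite inE => /orP[Ph | Ph] hx; apply/orP.
      by left; apply/cov1; exists h.
    by right; apply/cov2; exists h.
- rewrite !inE => /orP[Ph | Ph] /orP[Ph' | Ph'].
  + exact: dis1.
  + by move=> /(no_meet h h' x Ph Ph')/negP.
  + by move=> hx /(no_meet h' h x Ph' Ph)/negP.
  + exact: dis2.
Qed.

Section Coherent.
Variables (N : finType) (e : rel N) (g : N -> nat).
Hypothesis eg : is_depth e g.

Lemma parent_closed_coherent h : parent_closed e h -> coherent e g h.
Proof.
move=> clos; split=> [x y hx hy gxy | x1 y1 x2 y2 hx1 hy1 _ ex ey _].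
  have [|z yz] := depth_parent eg (x := y); first exact: leq_trans gxy.
  by exists z => //; apply: clos yz hy.
by split; [apply: clos ex hx1 | apply: clos ey hy1].
Qed.

(** A node of [h] that has a parent is deeper than the root [r], so that
    condition (1) applies to the two. *)
Lemma coherent_parent_closed h r :
  coherent e g h -> r \in h -> g r = 0 -> parent_closed e h.
Proof.
move=> [coh _] hr gr0 x y xy hx.
have [|z hz xz] := coh r x hr hx; first by rewrite gr0 (depth_edge eg xy).
by rewrite (depth_fun eg xy xz).
Qed.

Lemma parent_closed_root h x :
  parent_closed e h -> x \in h -> exists2 r, r \in h & g r = 0.
Proof.
move=> clos hx; have [p xp gp] := depth_root_path eg x.
exists (last x p) => //.
by elim: p x hx xp {gp} => //= y p IHp x hx /andP[xy]; apply: IHp; apply: clos hx.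
Qed.

End Coherent.

Lemma eq_coherent (N : finType) (e : rel N) (g g' : N -> nat) h :
  g =1 g' -> coherent e g h -> coherent e g' h.
Proof.
move=> eq_g [c1 c2]; split=> [x y | x1 y1 x2 y2].
  by rewrite -!eq_g; apply: c1.
by rewrite -!eq_g; apply: c2.
Qed.

Lemma hyperedgesP d (T : hypergraph d) (h : {set node T}) :
  (h \in hyperedges T) =
  (h != set0) && ((h \in untagged_edges T) || (h == tagged_edge T)).
Proof. by rewrite !inE. Qed.

Lemma is_lions_forestP d (T : hypergraph d) :
  is_lions_forest T <-> exists g, @lions_wrt d T g.
Proof.
split=> [[forest part coh1 coh2 root0] | [g [eg part coh clos]]].
  have eg := depth_is_depth forest; exists (depth (@edge d T)).
  have coh h : h \in hyperedges T -> coherent (@edge d T) (depth (@edge d T)) h.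
    by move=> Th; split=> [x y | x1 y1 x2 y2]; [apply: coh1 | apply: coh2].
  split=> // [h Hh | x y xy hx].
    apply: coh; rewrite hyperedgesP Hh andbT.
    have [nH0 _ _] := (partitionE _ _).1 part.
    by apply: contraNneq nH0 => <-.
  have h0 : tagged_edge T != set0 by apply/set0Pn; exists x.
  have [r hr] := root0 (elimN eqP h0); rewrite (depth_is_root eg) => /eqP gr0.
  apply: (coherent_parent_closed eg _ hr gr0 xy hx).
  by apply: coh; rewrite hyperedgesP h0 eqxx orbT.
have eq_g := depth_unique eg.
have {}coh h : h \in hyperedges T -> coherent (@edge d T) (depth (@edge d T)) h.
  move=> Th; apply: (eq_coherent (g := g)) => //.
  rewrite hyperedgesP in Th; case/andP: Th => _ /orP[/coh // | /eqP->].
  exact: parent_closed_coherent.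
split=> // [|h x y /coh[c1 _]|h x1 y1 x2 y2 /coh[_ c2]|].
- exact: depth_directed_forest eg.
- exact: c1.
- exact: c2.
move=> /eqP/set0Pn[x /(parent_closed_root eg clos)[r hr gr0]].
by exists r; rewrite // (depth_is_root eg) gr0.
Qed.

(** * The operations preserve Lions forests *)

Lemma is_depth_root d (T : hypergraph d) g x :
  lions_wrt (T := T) g -> is_root (@edge d T) x = (g x == 0).
Proof. by case=> eg _ _ _; apply: depth_is_root. Qed.

(** The image of a coherent hyperedge under an embedding which shifts depths by
    a constant is coherent. Edges may leave the image of the embedding as long
    as condition (2) never applies to them: in a rooting they all lead from the
    old roots to the new one. *)
Lemma coherent_imset (N N' : finType) (e : rel N) (e' : rel N') g g' k
    (f : N -> N') (h : {set N}) :
  (forall x, g' (f x) = k + g x) ->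
  (forall x y, e x y -> e' (f x) (f y)) ->
  (forall x y x' y', g x = g y -> e' (f x) x' -> e' (f y) y' -> x' <> y' ->
     exists x2 y2, [/\ x' = f x2, y' = f y2, e x x2 & e y y2]) ->
  coherent e g h -> coherent e' g' (f @: h).
Proof.
move=> gf ef out [c1 c2]; split.
  move=> _ _ /imsetP[x hx ->] /imsetP[y hy ->].
  rewrite !gf ltn_add2l => /(c1 x y hx hy)[z hz yz].
  by exists (f z); [apply: imset_f | apply: ef].
move=> _ _ x' y' /imsetP[x hx ->] /imsetP[y hy ->].
rewrite !gf => /addnI gxy xx' yy' neq.
have [x2 [y2 [Dx Dy xx2 yy2]]] := out x y x' y' gxy xx' yy' neq; subst x' y'.
have [|hx2 hy2] := c2 x y x2 y2 hx hy gxy xx2 yy2.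
  by move=> Dxy; rewrite Dxy in neq.
by split; apply: imset_f.
Qed.

Lemma lions_isomorphic d (T1 T2 : hypergraph d) :
  isomorphic T1 T2 -> is_lions_forest T1 -> is_lions_forest T2.
Proof.
case=> f [[f' fK f'K] fe fh0 fH _] /is_lions_forestP[g [eg part coh clos]].
have inj_f := can_inj fK.
apply/is_lions_forestP; exists (g \o f').
have fe' x y : edge (f' x) (f' y) = edge x y by rewrite -fe !f'K.
have edge_out x y : edge (f x) y -> y = f (f' y) /\ edge x (f' y).
  by rewrite -fe f'K.
split.
- split=> [x y z | x y | x] /=.
  + rewrite -!fe' => xy xz; apply: (can_inj f'K).
    exact: depth_fun eg _ _ _ xy xz.
  + by rewrite -fe'; apply: depth_edge eg _ _.
  + by case/(depth_parent eg) => y; exists (f y); rewrite -[x]f'K fe.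
- rewrite -fh0 -fH; have -> : ~: (f @: tagged_edge T1) = f @: ~: tagged_edge T1.
    by apply/setP => x; rewrite -[x]f'K inE !mem_imset // inE.
  by rewrite imset_partition.
- rewrite -fH => _ /imsetP[h Hh ->]; apply: (coherent_imset (k := 0)) (coh h Hh).
  + by move=> x; rewrite /= fK.
  + by move=> x y; rewrite fe.
  + move=> x y x' y' _ /edge_out[Dx xx'] /edge_out[Dy yy'] _.
    by exists (f' x'), (f' y').
- move=> x y; rewrite -fe' -fh0 => xy; rewrite -[x]f'K -[y]f'K !mem_imset //.
  exact: clos.
Qed.

Lemma lions_empty_forest d : is_lions_forest (empty_forest d).
Proof.
apply/is_lions_forestP; exists (fun=> 0); split.
- by split; case.
- by apply/partitionE; split=> [|[]|h h' []]; rewrite inE.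
- by move=> h; rewrite inE.
- by case.
Qed.

Lemma lions_decoupling d (T : hypergraph d) :
  is_lions_forest T -> is_lions_forest (decoupling T).
Proof.
case/is_lions_forestP=> g [eg part coh clos].
apply/is_lions_forestP; exists g; split=> //=.
- have [nH0 covH disjH] := (partitionE _ _).1 part.
  apply/partitionE; split=> [|x|h h' x].
  + by rewrite hyperedgesP eqxx.
  + rewrite !inE; split=> // _.
    have [hx | nhx] := boolP (x \in tagged_edge T).
      exists (tagged_edge T); rewrite // hyperedgesP eqxx orbT andbT.
      by apply/set0Pn; exists x.
    have [h Hh hx] : exists2 h, h \in untagged_edges T & x \in h.
      by apply/covH; rewrite inE.
    by exists h; rewrite // hyperedgesP Hh andbT; apply/set0Pn; exists x.
  + have no_meet h1 : h1 \in untagged_edges T -> x \in h1 ->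
        x \notin tagged_edge T.
      by move=> Hh1 h1x; rewrite -in_setC; apply/covH; exists h1.
    rewrite !hyperedgesP => /andP[_ /orP[Hh | /eqP->]]
      /andP[_ /orP[Hh' | /eqP->]] //.
    * exact: disjH.
    * by move=> /(no_meet h Hh)/negP.
    * by move=> hx /(no_meet h' Hh')/negP.
- move=> h; rewrite hyperedgesP => /andP[_ /orP[/coh // | /eqP->]].
  exact: parent_closed_coherent.
- by move=> x y _; rewrite inE.
Qed.

Lemma in_inl_imset (A B : finType) (h : {set A}) (u : A + B) :
  (u \in inl @: h) = if u is inl x then x \in h else false.
Proof.
case: u => x; first by rewrite mem_imset //; apply: inl_inj.
by apply/imsetP => -[].
Qed.

Lemma in_inr_imset (A B : finType) (h : {set B}) (u : A + B) :
  (u \in inr @: h) = if u is inr x then x \in h else false.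
Proof.
case: u => x; last by rewrite mem_imset //; apply: inr_inj.
by apply/imsetP => -[].
Qed.

Lemma in_Some_imset (A : finType) (h : {set A}) (u : option A) :
  (u \in Some @: h) = if u is Some x then x \in h else false.
Proof.
case: u => [x|]; first by rewrite mem_imset //; apply: Some_inj.
by apply/imsetP => -[].
Qed.

Lemma lions_product d (T1 T2 : hypergraph d) :
  is_lions_forest T1 -> is_lions_forest T2 -> is_lions_forest (product T1 T2).
Proof.
move=> /is_lions_forestP[g1 [eg1 part1 coh1 clos1]].
move=> /is_lions_forestP[g2 [eg2 part2 coh2 clos2]].
apply/is_lions_forestP.
exists (fun u => match u with inl x => g1 x | inr x => g2 x end); split.
- split=> [[x|x] [y|y] [z|z] | [x|x] [y|y] | [x|x]] //=.
  + by move=> xy xz; rewrite (depth_fun eg1 xy xz).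
  + by move=> xy xz; rewrite (depth_fun eg2 xy xz).
  + exact: depth_edge.
  + exact: depth_edge.
  + by case/(depth_parent eg1)=> y; exists (inl y).
  + by case/(depth_parent eg2)=> y; exists (inr y).
- have -> : ~: tagged_edge (product T1 T2) =
      inl @: (~: tagged_edge T1) :|: inr @: (~: tagged_edge T2).
    by apply/setP => -[x|x]; rewrite !(inE, in_inl_imset, in_inr_imset) ?orbF.
  apply: partition_setU.
  + apply/pred0P => -[x|x] /=; rewrite in_inl_imset in_inr_imset ?andbF //.
  + by rewrite (imset_partition _ _ inl_inj).
  + by rewrite (imset_partition _ _ inr_inj).
- move=> h; rewrite inE => /orP[] /imsetP[h' Hh' ->].
  + apply: (coherent_imset (k := 0)) (coh1 h' Hh') => //=.
    move=> x y [x'|x'] [y'|y'] //= _ xx' yy' _.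
    by exists x', y'.
  + apply: (coherent_imset (k := 0)) (coh2 h' Hh') => //=.
    move=> x y [x'|x'] [y'|y'] //= _ xx' yy' _.
    by exists x', y'.
- move=> [x|x] [y|y] //=; rewrite !(inE, in_inl_imset, in_inr_imset) ?orbF.
  + exact: clos1.
  + exact: clos2.
Qed.

Lemma lions_rooting d i (T : hypergraph d) :
  is_lions_forest T -> is_lions_forest (rooting i T).
Proof.
move=> /is_lions_forestP[g lions]; have rootE x := is_depth_root x lions.
case: lions => eg part coh clos; apply/is_lions_forestP.
exists (fun u => if u is Some x then (g x).+1 else 0); split.
- split=> [[x|] [y|] [z|] | [x|] [y|] | [x|]] //=.
  + by move=> xy xz; rewrite (depth_fun eg xy xz).
  + by move=> /(depth_edge eg) gx; rewrite rootE gx.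
  + by move=> + /(depth_edge eg) gx; rewrite rootE gx.
  + by move=> /(depth_edge eg)->.
  + by rewrite rootE => /eqP->.
  + move=> _; have [gx0 | /(depth_parent eg)[y xy]] := posnP (g x).
      by exists None; rewrite rootE gx0.
    by exists (Some y).
- have -> : ~: tagged_edge (rooting i T) = Some @: (~: tagged_edge T).
    by apply/setP => -[x|]; rewrite !(inE, in_Some_imset).
  by rewrite (imset_partition _ _ Some_inj).
- move=> _ /imsetP[h Hh ->].
  apply: (coherent_imset (k := 1)) (coh h Hh) => //= x y [x'|] [y'|] gxy //=.
  + by move=> xx' yy' _; exists x', y'.
  + by rewrite rootE -gxy => /(depth_edge eg)->.
  + by move=> + /(depth_edge eg) gy; rewrite rootE gxy gy.
- move=> [x|] [y|] //=; rewrite !(inE, in_Some_imset) //=.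
  exact: clos.
Qed.

Lemma completion_lions d (T : hypergraph d) :
  completion (fun T0 => T0 = empty_forest d) T -> is_lions_forest T.
Proof.
elim=> [_ -> | T1 T2 iso _ | T1 T2 _ lions1 _ | T1 _ | i T1 _].
- exact: lions_empty_forest.
- exact: lions_isomorphic.
- exact: lions_product.
- exact: lions_decoupling.
- exact: lions_rooting.
Qed.

(** * Decomposition of Lions forests *)

(** The restriction of [T] to a set [S] of nodes; the traces of the hyperedges
    on [S] which are empty are left out. *)
Definition restriction d (T : hypergraph d) (S : {set node T}) : hypergraph d :=
  @Hypergraph d {x : node T | x \in S}
    (fun x y => edge (val x) (val y))
    [set x | val x \in tagged_edge T]
    ([set [set x | val x \in (h : {set node T})] | h in untagged_edges T] :\ set0)
    (fun x => label (val x)).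

Lemma card_restriction d (T : hypergraph d) S :
  #|node (restriction (T := T) S)| = #|S|.
Proof. by rewrite /= card_sig; apply: eq_card => x; rewrite inE. Qed.

(** The restriction to [S] has the depth function [g - k] when all nodes of [S]
    have depth at least [k], and those of larger depth have their parent in [S]. *)
Lemma lions_restriction d (T : hypergraph d) g k (S : {set node T}) :
  lions_wrt g ->
  (forall x, x \in S -> k <= g x) ->
  (forall x y, x \in S -> edge x y -> k < g x -> y \in S) ->
  lions_wrt (T := restriction S) (fun x => g (val x) - k).
Proof.
case=> eg part coh clos geS outS; split.
- split=> [x y z xy xz | x y xy | x].
  + exact/val_inj/(depth_fun eg xy xz).
  + by rewrite (depth_edge eg xy) subSn // geS // (valP y).
  + rewrite subn_gt0 => gx.
    have [y xy] := depth_parent eg (leq_ltn_trans (leq0n k) gx).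
    by exists (Sub y (outS _ _ (valP x) xy gx)).
- have [_ covH disjH] := (partitionE _ _).1 part.
  apply/partitionE; split=> [|x|h h' x] /=.
  + by rewrite !inE eqxx.
  + have := covH (val x); rewrite !inE => covx.
    split=> [/covx[h Hh hx] | [h]].
      exists [set y : {y | y \in S} | val y \in h]; last by rewrite inE.
      rewrite !inE imset_f // andbT.
      by apply/set0Pn; exists x; rewrite inE.
    rewrite !inE => /andP[_ /imsetP[h' Hh' ->]]; rewrite inE => h'x.
    by apply/covx; exists h'.
  + rewrite !inE => /andP[_ /imsetP[h1 Hh1 ->]] /andP[_ /imsetP[h2 Hh2 ->]].
    by rewrite !inE => h1x h2x; rewrite (disjH h1 h2 (val x)).
- move=> h /setD1P[_ /imsetP[h1 /coh[c1 c2] ->]]; split.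
    move=> x y; rewrite !inE => hx hy gxy.
    have gy : k < g (val y) by rewrite -subn_gt0; apply: leq_ltn_trans gxy.
    have gxy' : g (val x) < g (val y).
      by rewrite -(ltn_sub2rE _ (geS _ (valP x))).
    have [z hz yz] := c1 _ _ hx hy gxy'.
    have Sz := outS _ _ (valP y) yz gy.
    by exists (Sub z Sz); rewrite ?inE.
  move=> x1 y1 x2 y2; rewrite !inE => hx hy gxy xx yy neq.
  apply: c2 hx hy _ xx yy _; last by move=> /val_inj.
  by rewrite -(subnK (geS _ (valP x1))) gxy subnK // geS // (valP y1).
- by move=> x y xy; rewrite !inE; apply: clos.
Qed.

Section Decomposition.
Variables (d : nat) (T : hypergraph d) (g : node T -> nat).
Hypothesis lionsT : lions_wrt g.

Local Notation e := (@edge d T).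

Let eg : is_depth e g. Proof. by case: lionsT. Qed.
Let part : partition (untagged_edges T) (~: tagged_edge T).
Proof. by case: lionsT. Qed.
Let coh h : h \in untagged_edges T -> coherent e g h.
Proof. by case: lionsT => _ _ coh _; apply: coh. Qed.
Let clos : parent_closed e (tagged_edge T).
Proof. by case: lionsT => _ _ _ clos; apply: clos. Qed.

Lemma lions_void_isomorphic : #|node T| = 0 -> isomorphic (empty_forest d) T.
Proof.
move=> T0; have no_node (x : node T) : False by have := fintype0 x T0.
exists (fun x : void => match x with end); split=> //.
- by exists (fun x => False_rect void (no_node x)) => [[]|x]; case: (no_node x).
- by apply/setP => x; case: (no_node x).
- rewrite /= imset0; have [nH0 _ _] := (partitionE _ _).1 part.
  apply/setP => h; rewrite inE; apply/esym; apply: contraNF nH0.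
  by rewrite (_ : h = set0) //; apply/setP => x; case: (no_node x).
Qed.

(** If no hyperedge is tagged, tagging one that contains a root inverts the
    decoupling. The node [x] only witnesses that [T] is nonempty. *)
Lemma lions_tagging (x : node T) :
  tagged_edge T = set0 ->
  exists2 h : {set node T}, h != set0 &
    let T' := @Hypergraph d (node T) e h (untagged_edges T :\ h) (@label d T) in
    is_lions_forest T' /\ isomorphic (decoupling T') T.
Proof.
move=> tag0; have [nH0 covH disjH] := (partitionE _ _).1 part.
have [p _ gr] := depth_root_path eg x.
have [h Hh hr] : exists2 h, h \in untagged_edges T & last x p \in h.
  by apply/covH; rewrite tag0 inE inE.
have h_neq0 : h != set0 by apply: contraNneq nH0 => <-.
exists h => // T'; split.
  apply/is_lions_forestP; exists g; split=> //=.
  - apply/partitionE; split=> [|y|h1 h2 y].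
    + by rewrite !inE negb_and nH0 orbT.
    + rewrite inE; split=> [nhy | [h1 /setD1P[neq_h Hh1] h1y]].
        have [h1 Hh1 h1y] : exists2 h1, h1 \in untagged_edges T & y \in h1.
          by apply/covH; rewrite tag0 !inE.
        by exists h1; rewrite // !inE Hh1 andbT; apply: contraNneq nhy => <-.
      by apply: contra neq_h => hy; rewrite (disjH h1 h y).
    + by move=> /setD1P[_ H1] /setD1P[_ H2]; apply: disjH.
  - by move=> h1 /setD1P[_ /coh].
  - exact: coherent_parent_closed (coh Hh) hr gr.
exists id; split=> //=.
- by exists id.
- by rewrite imset0.
- transitivity (hyperedges T').
    have id_set (A : {set node T}) : id @: A = A by apply: imset_id.
    apply/setP => h1; apply/imsetP/idP => [[h2 ? ->] | ?]; last exists h1;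
      by rewrite ?id_set.
  apply/setP => h1; rewrite /hyperedges !inE /=.
  have [-> | neq] := eqVneq h1 h; first by rewrite h_neq0 Hh orbT.
  rewrite /= orbF; case: (boolP (h1 \in _)) => [Hh1|]; rewrite ?andbF // andbT.
  by apply: contraNneq nH0 => <-.
Qed.

(** A tree with tagged root [r] is a rooting of the forest of its other
    nodes. *)
Lemma rooting_isomorphic (r : node T) :
  r \in tagged_edge T -> g r = 0 -> (forall x, connect e x r) ->
  is_lions_forest (restriction [set~ r])
  /\ isomorphic (rooting (label r) (restriction [set~ r])) T.
Proof.
move=> tag_r gr0 to_r.
have root0 x : g x = 0 -> x = r.
  by move=> gx0; rewrite (connect_depth0 eg gx0 (to_r x)).
have gS x : x \in [set~ r] -> 1 <= g x.
  by rewrite !inE lt0n; apply: contraNneq => /root0->.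
have lionsR : lions_wrt (T := restriction [set~ r]) (fun x => g (val x) - 1).
  apply: lions_restriction => // x y _ xy gx; rewrite !inE.
  by apply: contraTneq gx => Dy; rewrite (depth_edge eg xy) Dy gr0.
split; first by apply/is_lions_forestP; eexists; apply: lionsR.
pose f (u : option {x | x \in [set~ r]}) := if u is Some x then val x else r.
have neq_r (x : {x | x \in [set~ r]}) : val x != r by have := valP x; rewrite !inE.
have inj_f : injective f.
  move=> [x|] [y|] //= => [/val_inj-> // | Dx | Dy].
    by case/eqP: (neq_r x).
  by case/eqP: (neq_r y).
have fE (x : node T) : x != r -> exists u, x = val (u : {x | x \in [set~ r]}).
  rewrite -in_set1 -in_setC => Sx; by exists (Sub x Sx); rewrite SubK.
exists f; split=> [||| |[x|]] //.
- exists (fun x => insub x) => [[x|] | x] /=; first by rewrite valK.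
    by rewrite insubN // !inE eqxx.
  by case: insubP => //=; rewrite !inE negbK => /eqP.
- move=> [x|] [y|] //=.
  + have gx := gS _ (valP x); rewrite (is_depth_root _ lionsR).
    rewrite subn_eq0; apply/idP/idP => [/(depth_edge eg)-> | gx1].
      by rewrite gr0.
    have [y xy] := depth_parent eg gx; have Dy : y = r.
      by apply: root0; move: gx1; rewrite (depth_edge eg xy) ltnS leqn0 => /eqP.
    by move: xy; rewrite [in X in X -> _]Dy.
  + exact/negbTE/(depth0_no_parent eg).
  + exact/negbTE/(depth0_no_parent eg).
- apply/setP => x; apply/imsetP/idP => [[[y|]] | tag_x] /=.
  + by rewrite !(inE, in_Some_imset) => ? ->.
  + by move=> _ ->.
  have [Dx | /fE[y Dx]] := eqVneq x r; first by exists None; rewrite // !inE.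
  by exists (Some y); rewrite // !(inE, in_Some_imset) -Dx.
- have [nH0 covH disjH] := (partitionE _ _).1 part.
  have fK h : h \in untagged_edges T ->
      f @: (Some @: [set x : {x | x \in [set~ r]} | val x \in h]) = h.
    move=> Hh; apply/setP => x; apply/imsetP/idP => [[[y|]] | hx].
    + by rewrite in_Some_imset inE => ? ->.
    + by rewrite in_Some_imset.
    have /fE[y Dx] : x != r.
      apply: contraTneq tag_r => <-; rewrite -in_setC.
      by apply/covH; exists h.
    by exists (Some y); rewrite // in_Some_imset inE -Dx.
  apply/setP => h; apply/imsetP/idP => [[h1] | Hh].
    by case/imsetP => h2 /setD1P[_ /imsetP[h3 Hh3 ->]] -> ->; rewrite fK.
  pose h1 := [set x : {x | x \in [set~ r]} | val x \in h].
  exists (Some @: h1); last by rewrite fK.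
  apply: imset_f; rewrite !inE imset_f // andbT; apply: contraNneq nH0 => h1_0.
  by rewrite -(imset0 f) -(imset0 Some) -h1_0 fK.
Qed.

(** The component of a tagged root [r] and the rest of the forest are Lions
    forests with product [T]. Indeed, a hyperedge that meets both contains [r], since climbing
    in parallel from a node in the component and a node outside, according to
    the coherence conditions, ends in two roots; so it is the tagged one. *)
Lemma product_isomorphic (r : node T) :
  r \in tagged_edge T -> g r = 0 ->
  let S := [set x | connect e x r] in
  [/\ is_lions_forest (restriction S), is_lions_forest (restriction (~: S))
    & isomorphic (product (restriction S) (restriction (~: S))) T].
Proof.
move=> tag_r gr0 S.
have Sedge x y : e x y -> (x \in S) = (y \in S).
  move=> xy; rewrite !inE; apply/idP/idP.
    exact: connect_parent eg _ _ _ gr0 xy.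
  exact/connect_trans/connect1.
have lionsR (S' : {set node T}) :
    (forall x y, e x y -> (x \in S') = (y \in S')) ->
    lions_wrt (T := restriction S') (fun x => g (val x) - 0).
  by move=> S'e; apply: lions_restriction => // x y S'x xy _; rewrite -(S'e x y).
have SCedge x y : e x y -> (x \in ~: S) = (y \in ~: S).
  by move=> xy; rewrite !in_setC (Sedge x y).
split; try by apply/is_lions_forestP; eexists; apply: lionsR.
have root_in h x y : coherent e g h ->
    x \in h -> x \in S -> y \in h -> y \notin S -> r \in h.
  case=> c1 c2; move: {2}(g x + g y).+1 (ltnSn (g x + g y)) => n.
  elim: n x y => // n IHn x y; rewrite ltnS => le_n hx Sx hy nSy.
  case: (ltngtP (g x) (g y)) => gxy.
  - have [z hz yz] := c1 x y hx hy gxy; apply: (IHn x z) => //.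
      by apply: leq_trans le_n; rewrite (depth_edge eg yz) addnS.
    by rewrite -(Sedge y z).
  - have [z hz xz] := c1 y x hy hx gxy; apply: (IHn z y) => //.
      by apply: leq_trans le_n; rewrite (depth_edge eg xz).
    by rewrite -(Sedge x z).
  have [gx0 | gx] := posnP (g x).
    by rewrite inE in Sx; rewrite (connect_depth0 eg gx0 Sx).
  have [x2 xx2] := depth_parent eg gx.
  have [y2 yy2] : exists y2, e y y2 by apply: depth_parent eg _ _; rewrite -gxy.
  have Sx2 : x2 \in S by rewrite -(Sedge x x2).
  have nSy2 : y2 \notin S by rewrite -(Sedge y y2).
  have [|hx2 hy2] := c2 x y x2 y2 hx hy gxy xx2 yy2.
    by move=> Dx2; rewrite -Dx2 Sx2 in nSy2.
  apply: (IHn x2 y2) => //; apply: leq_trans le_n.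
  by rewrite (depth_edge eg xx2) (depth_edge eg yy2) addSn addnS ltnW.
have [nH0 covH disjH] := (partitionE _ _).1 part.
have one_side h : h \in untagged_edges T -> h \subset S \/ h \subset ~: S.
  move=> Hh; have [|/subsetPn[y hy nSy]] := boolP (h \subset S); first by left.
  right; apply/subsetP => x hx; rewrite in_setC; apply/negP => Sx.
  have : r \in ~: tagged_edge T.
    by apply/covH; exists h => //; apply: root_in (coh Hh) hx Sx hy nSy.
  by rewrite inE tag_r.
pose f (u : {x | x \in S} + {x | x \in ~: S}) :=
  match u with inl x => val x | inr x => val x end.
have nS (x : {x | x \in ~: S}) : val x \notin S by rewrite -in_setC; apply: valP.
have fSC (x : {x | x \in S}) (y : {x | x \in ~: S}) : val x <> val y.
  by move=> Dx; have := nS y; rewrite -Dx (valP x).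
have inj_f : injective f.
  move=> [x|x] [y|y] //= => [/val_inj-> // | /fSC // | /esym/fSC // | /val_inj-> //].
have fE x : (exists u, x = f (inl u)) \/ (exists u, x = f (inr u)).
  have [Sx | nSx] := boolP (x \in S); first by left; exists (Sub x Sx).
  by rewrite -in_setC in nSx; right; exists (Sub x nSx).
have f_onto x : exists u, f u == x.
  by case: (fE x) => -[u ->]; eexists.
exists f; split=> [||| |[x|x]] //.
- exists (fun x => xchoose (f_onto x)) => [u | x];
    last exact/eqP/(xchooseP (f_onto x)).
  exact/inj_f/eqP/(xchooseP (f_onto (f u))).
- move=> [x|x] [y|y] //=; apply/negP => /Sedge.
    by rewrite (valP x) (negbTE (nS y)).
  by rewrite (valP y) (negbTE (nS x)).
- apply/setP => x; apply/imsetP/idP => [[[y|y]] | tag_x].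
  + by rewrite !(inE, in_inl_imset, in_inr_imset) orbF => ? ->.
  + by rewrite !(inE, in_inl_imset, in_inr_imset) => ? ->.
  case: (fE x) => -[u Dx]; move: tag_x; rewrite Dx => tag_u.
    by exists (inl u); rewrite // inE in_inl_imset in_inr_imset orbF inE.
  by exists (inr u); rewrite // inE in_inl_imset in_inr_imset inE.
have fl (h : {set node T}) : h \subset S ->
    f @: (inl @: [set x : {x | x \in S} | val x \in h]) = h.
  move/subsetP=> hS; apply/setP => x; apply/imsetP/idP => [[[y|y]] | hx].
  + by rewrite in_inl_imset inE => ? ->.
  + by rewrite in_inl_imset.
  exists (inl (Sub x (hS x hx))) => //.
  by rewrite in_inl_imset inE.
have fr (h : {set node T}) : h \subset ~: S ->
    f @: (inr @: [set x : {x | x \in ~: S} | val x \in h]) = h.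
  move/subsetP=> hS; apply/setP => x; apply/imsetP/idP => [[[y|y]] | hx].
  + by rewrite in_inr_imset.
  + by rewrite in_inr_imset inE => ? ->.
  exists (inr (Sub x (hS x hx))) => //.
  by rewrite in_inr_imset inE.
have meets (S' h : {set node T}) :
    [set x : {x | x \in S'} | val x \in h] != set0 ->
    exists x, x \in h /\ x \in S'.
  by case/set0Pn=> x; rewrite inE => hx; exists (val x); split=> //; apply: valP.
apply/setP => h; apply/imsetP/idP => [[h1] | Hh].
  rewrite inE => /orP[] /imsetP[h2 /setD1P[h2_0 /imsetP[h3 Hh3 Dh2]] ->] ->;
    rewrite Dh2 in h2_0 *.
  - have [x [hx Sx]] := meets S h3 h2_0; rewrite fl //.
    by case: (one_side h3 Hh3) => // /subsetP/(_ x hx); rewrite in_setC Sx.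
  - have [x [hx Sx]] := meets (~: S) h3 h2_0; rewrite fr //.
    case: (one_side h3 Hh3) => // /subsetP/(_ x hx) Sx'.
    by rewrite in_setC Sx' in Sx.
have h0 : h != set0 by apply: contraNneq nH0 => <-.
case: (one_side h Hh) => hS.
  exists (inl @: [set x : {x | x \in S} | val x \in h]); last by rewrite fl.
  rewrite inE; apply/orP; left; rewrite imset_f // !inE imset_f // andbT.
  by apply: contraNneq h0 => h1_0; rewrite -(fl h hS) h1_0 !imset0.
exists (inr @: [set x : {x | x \in ~: S} | val x \in h]); last by rewrite fr.
rewrite inE; apply/orP; right; rewrite imset_f // !inE imset_f // andbT.
by apply: contraNneq h0 => h1_0; rewrite -(fr h hS) h1_0 !imset0.
Qed.

End Decomposition.

Lemma lions_completion d (T : hypergraph d) :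
  is_lions_forest T -> completion (fun T0 => T0 = empty_forest d) T.
Proof.
(* The nodes are counted twice, so that deleting some of them decreases the
   weight even if no hyperedge remains tagged. *)
pose weight T1 := (#|node T1|).*2 + (@tagged_edge d T1 == set0).
move: {2}(weight T).+1 (ltnSn (weight T)) => n; rewrite {}/weight.
elim: n T => // n IHn T; rewrite ltnS => le_n /is_lions_forestP[g lionsT].
have [T0 | T_gt0] := posnP #|node T|.
  apply: completion_isomorphic (lions_void_isomorphic lionsT T0) _.
  exact: completion_base.
have [eg _ _ clos] := lionsT.
have [tag0 | /set0Pn[x tag_x]] := eqVneq (tagged_edge T) set0.
  have [x _] : exists x : node T, true by case/card_gt0P: T_gt0 => x; exists x.
  have [h h0 [lions' iso]] := lions_tagging lionsT x tag0.
  apply: (completion_isomorphic iso); apply/completion_decoupling/IHn => //=.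
  by move: le_n; rewrite tag0 eqxx (negbTE h0) addn0 addn1.
have [r tag_r gr0] := parent_closed_root eg clos tag_x.
have smaller (S : {set node T}) : #|S| < #|node T| ->
    is_lions_forest (restriction S) ->
    completion (fun T0 => T0 = empty_forest d) (restriction S).
  move=> ltS lionsS; apply: IHn lionsS; rewrite card_restriction.
  apply: leq_trans le_n; apply: leq_trans (leq_addr _ _).
  apply: leq_trans (_ : #|S|.+1.*2 <= _); last by rewrite leq_double.
  by rewrite doubleS ltnS -addn1 leq_add2l leq_b1.
have [/forallP to_r | /forallPn[y nyr]] := boolP [forall y, connect (@edge d T) y r].
  have [lionsR iso] := rooting_isomorphic lionsT tag_r gr0 to_r.
  apply: (completion_isomorphic iso); apply/completion_rooting/smaller => //.
  by rewrite cardsC1 prednK.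
have [lions1 lions2 iso] := product_isomorphic lionsT tag_r gr0.
have ltS (S : {set node T}) z : z \notin S -> #|S| < #|node T|.
  move=> nSz; rewrite -cardsT; apply: proper_card; rewrite properT.
  by apply: contraNneq nSz => ->.
apply: (completion_isomorphic iso); apply: completion_product; apply: smaller => //.
- by apply: (ltS _ y); rewrite inE.
- by apply: (ltS _ r); rewrite !inE connect0.
Qed.

Theorem proposition4p15 (d : nat) (T : hypergraph d) :
  completion (fun T0 => T0 = empty_forest d) T <-> is_lions_forest T.
Proof. by split; [apply: completion_lions | apply: lions_completion]. Qed.
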